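(* Let $s\ge1$ be an integer and $\mu>0$. The expected waiting time $W(s,\lambda)$ in the M/M/$s$ queue, as a function of $\lambda\in(0,s\mu)$, has a convex derivative; that is, $\lambda\mapsto\frac{\partial}{\partial\lambda}W(s,\lambda)$ is convex on $(0,s\mu)$.
   Context: $W(s,\lambda)$ denotes the stationary expected waiting time (including time in service) in the M/M/$s$ queue with Poisson arrivals of rate $\lambda$ and $s$ parallel servers each with service rate $\mu$. Explicitly, with $\rho=\lambda/(s\mu)\in(0,1)$, $$W(s,\lambda)=\frac{L(s,\lambda)}{\lambda},\qquad L(s,\lambda)=s\rho+\frac{\rho}{1-\rho}C(s,\lambda),$$ where $C(s,\lambda)$ is the Erlang-C delay probability $$C(s,\lambda)=\frac{\frac{(\lambda/\mu)^s}{s!}\frac{1}{1-\rho}}{\sum_{k=0}^{s-1}\frac{(\lambda/\mu)^k}{k!}+\frac{(\lambda/\mu)^s}{s!}\frac{1}{1-\rho}}.$$ *)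

(* Defs.v *)
From mathcomp Require Import all_boot all_order all_algebra.
From mathcomp Require Import all_classical all_reals all_analysis.

Set Implicit Arguments.
Unset Strict Implicit.
Unset Printing Implicit Defensive.

Import Order.TTheory GRing.Theory Num.Theory.
Import numFieldNormedType.Exports.

Local Open Scope ring_scope.

(** M/M/s queue with arrival rate [lambda] and [s] servers of rate [mu] each.
    The formulas are meaningful in the stable regime 0 < lambda < s * mu; the
    definitions are total, with no meaning attached to other arguments. *)
Section MMs.
Context {R : realType}.
Implicit Types (mu lambda : R) (s : nat).

Definition utilization mu s lambda : R := lambda / (s%:R * mu).

Definition erlangC mu s lambda : R :=
  let rho := utilization mu s lambda in
  let a := lambda / mu in
  let all_busy := a ^+ s / s`!%:R * (1 - rho)^-1 in
  all_busy / (\sum_(0 <= k < s) a ^+ k / k`!%:R + all_busy).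

(** Expected number of customers in the system, those in service included. *)
Definition expected_customers mu s lambda : R :=
  let rho := utilization mu s lambda in
  s%:R * rho + rho / (1 - rho) * erlangC mu s lambda.

(** Expected waiting time including service; by Little's law it is the expected
    number in the system divided by the arrival rate. *)
Definition waiting_time mu s lambda : R :=
  expected_customers mu s lambda / lambda.

End MMs.

(* Main.v *)
Require Import Defs.
From mathcomp Require Import all_boot all_order all_algebra.
From mathcomp Require Import all_classical all_reals all_analysis.
From mathcomp Require Import ring lra.
Import Order.TTheory GRing.Theory Num.Theory.
Import numFieldNormedType.Exports.
Local Open Scope ring_scope.

(** With [a = lambda / mu], the waiting time is [(1 + D a) / mu], where
    [D a = s e_s / ((s - a) P)], [e_k = a^k / k!], [E = sum_(k < s) e_k] and
    [P = sum_(k < s) (s - k) e_k] is the sum of the first [s] partial sums [E].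
    Put [p = (s - a) / a], [r = 1 / (s - a)] and [z = E / P].  Then
    [D' = (p + r + z) D] and [z' = z^2 + z p - 1 / a], a Riccati equation, so
    [D''' / D] is a cubic polynomial in [p], [r], [z].  Its negative terms are
    controlled by [1 / a = p r <= z^2 + z p] (that is, [z' >= 0]), which amounts to
    [e_(s-1) P <= E^2] and follows by induction on [s].  This suffices if
    [r <= 1/2] or [p <= 2], one of which always holds when [s >= 3]; for
    [s = 1, 2] the cubic is explicit. *)

Set Implicit Arguments.
Unset Strict Implicit.

(** * Nonnegativity of the cubic *)

Lemma cube_terms_ge0 (R : realFieldType) (p r : R) :
  0 < p -> 0 < r -> 2 * r <= 1 \/ p <= 2 ->
  0 <= 6 * r ^+ 3 + p ^+ 3 * ((1 - r) * (1 - 2 * r)).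
Proof.
move=> p0 r0 H.
have p30 : 0 <= p ^+ 3 by rewrite exprn_ge0// ltW.
have r30 : 0 <= r ^+ 3 by rewrite exprn_ge0// ltW.
have [r1|r1] := lerP (2 * r) 1.
  have : 0 <= p ^+ 3 * ((1 - r) * (1 - 2 * r)) by rewrite !mulr_ge0//; lra.
  lra.
have {H} p2 : p <= 2 by case: H => //; lra.
have p3 : p ^+ 3 <= 8.
  have : 0 <= (2 - p) * (p ^+ 2 + 2 * p + 4).
    by rewrite mulr_ge0 ?subr_ge0// !addr_ge0 ?mulr_ge0 ?exprn_ge0 ?ltW.
  lra.
have [q1|q1] := lerP 0 ((1 - r) * (1 - 2 * r)).
  by have := mulr_ge0 p30 q1; lra.
(* The factor is negative here, so [p ^+ 3 <= 8] bounds the product from below. The resulting cubic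
   in [r] is [6 r (r - 1/2)^2] plus the quadratic [22 r^2 - 51/2 r + 8], whose discriminant is
   negative. *)
have H : 8 * ((1 - r) * (1 - 2 * r)) <= p ^+ 3 * ((1 - r) * (1 - 2 * r)).
  by rewrite ler_nM2r.
have r3 : 0 <= 6 * r ^+ 3 + 8 * ((1 - r) * (1 - 2 * r)).
  have : 0 <= r * (r - 1/2) ^+ 2 by rewrite mulr_ge0 ?sqr_ge0 // ltW.
  have : 0 <= (r - 3/4) ^+ 2 by rewrite sqr_ge0.
  nra.
lra.
Qed.

(** [D''' / D], with [1 / a] written [p * r]. *)
Definition log_cubic (R : realFieldType) (p r z : R) : R :=
  p ^+ 3 + 6 * r ^+ 3 + 6 * z ^+ 3 + 7 * p ^+ 2 * z + 12 * p * z ^+ 2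
  + 6 * r ^+ 2 * z + 6 * r * z ^+ 2
  - (4 * p + 3 * p ^+ 2 + 4 * p * z) * (p * r) + 2 * p * (p * r) ^+ 2.

(** Take [4 p (z^2 + z p - p r) >= 0] off the cubic. The rest is a polynomial in [z] with
    nonnegative coefficients: the constant one is [cube_terms_ge0], the linear one is
    [6 r^2 + p^2 (3 - 4 r)]. *)
Lemma log_cubic_ge0 (R : realFieldType) (p r z : R) :
  0 < p -> 0 < r -> 0 < z -> p * r <= z ^+ 2 + z * p ->
  2 * r <= 1 \/ p <= 2 ->
  0 <= log_cubic p r z.
Proof.
move=> p0 r0 z0 h H.
have H1 := @cube_terms_ge0 _ p r p0 r0 H.
have H2 : 0 <= z * (6 * r ^+ 2 + p ^+ 2 * (3 - 4 * r)).
  apply: mulr_ge0; first exact: ltW.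
  have p20 := sqr_ge0 p; have r20 := sqr_ge0 r.
  have [r1|r1] := lerP (4 * r) 3.
    have : 0 <= p ^+ 2 * (3 - 4 * r) by rewrite mulr_ge0// subr_ge0.
    lra.
  have {H} p2 : p <= 2 by case: H => //; lra.
  have p22 : p ^+ 2 <= 4 by nra.
  have : 4 * (3 - 4 * r) <= p ^+ 2 * (3 - 4 * r) by rewrite ler_nM2r; lra.
  (* [6 r^2 + 4 (3 - 4 r)] equals [2/3 (3 r - 4)^2 + 4/3]. *)
  have := sqr_ge0 (3 * r - 4).
  nra.
have H3 : 0 <= 4 * p * (z ^+ 2 + z * p - p * r) by rewrite !mulr_ge0 ?(ltW p0)// subr_ge0.
have H4 : 0 <= 8 * p * z ^+ 2 by rewrite !mulr_ge0 ?exprn_ge0 ?ltW.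
have H5 : 0 <= 6 * r * z ^+ 2 by rewrite !mulr_ge0 ?exprn_ge0 ?ltW.
have H6 : 0 <= z ^+ 3 by rewrite exprn_ge0 ?ltW.
rewrite /log_cubic; lra.
Qed.

(** * A convexity criterion and rules of differentiation *)

Lemma convex_function_derive2_ge0 (R : realType) (a b : R) (f f1 f2 : R -> R) :
  (forall x, x \in `]a, b[ -> is_derive x 1 f (f1 x)) ->
  (forall x, x \in `]a, b[ -> is_derive x 1 f1 (f2 x)) ->
  (forall x, x \in `]a, b[ -> 0 <= f2 x) ->
  convex_function (`]a, b[%classic : set R) f.
Proof.
move=> df df1 f2ge0.
have mvt (g g1 : R -> R) (x y : R) : a < x -> y < b -> x <= y ->
    (forall u, u \in `]a, b[ -> is_derive u 1 g (g1 u)) ->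
    exists2 c, x <= c <= y & g y - g x = g1 c * (y - x).
  move=> ax yb xy dg.
  have sub u : u \in `[x, y] -> u \in `]a, b[.
    by rewrite !in_itv/= => /andP[xu uy]; rewrite (lt_le_trans ax)// (le_lt_trans uy).
  have dxy u : u \in `]x, y[ -> is_derive u 1 g (g1 u).
    by move=> /subset_itv_oo_cc /sub /dg.
  have cg : {within `[x, y], continuous g}%classic.
    by apply: derivable_within_continuous => u /sub /dg [].
  by have [c] := MVT_segment xy dxy cg; rewrite in_itv/=; exists c.
(* Mean values of [f] on [[x, z]] and [[z, y]] give slopes [f1 c] and [f1 d] with [c <= d]; a third
   mean value, of [f1] on [[c, d]], orders them. The convexity gap is exactly
   [t (1 - t) (y - x) (f1 d - f1 c)]. *)
have key (x y t : R) : a < x -> y < b -> x <= y -> 0 <= t <= 1 ->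
    f (t * x + (1 - t) * y) <= t * f x + (1 - t) * f y.
  move=> ax yb xy /andP[t0 t1]; set z := t * x + (1 - t) * y.
  have xz : x <= z by rewrite /z; nra.
  have zy : z <= y by rewrite /z; nra.
  have [c /andP[xc cz] ec] := mvt _ _ x z ax (le_lt_trans zy yb) xz df.
  have [d /andP[zd dy] ed] := mvt _ _ z y (lt_le_trans ax xz) yb zy df.
  have cd := le_trans cz zd.
  have [e /andP[ce ed'] e2] := mvt _ _ c d (lt_le_trans ax xc) (le_lt_trans dy yb) cd df1.
  have e20 : 0 <= f2 e.
    apply: f2ge0; rewrite in_itv/= (lt_le_trans ax (le_trans xc ce)).
    exact: le_lt_trans (le_trans ed' dy) yb.
  have Hcd : 0 <= f1 d - f1 c by rewrite e2 mulr_ge0// subr_ge0.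
  have E1 : f z = f x + f1 c * (1 - t) * (y - x) by move: ec; rewrite /z; lra.
  have E2 : f y = f z + f1 d * t * (y - x) by move: ed; rewrite /z; lra.
  have : 0 <= t * (1 - t) * (y - x) * (f1 d - f1 c).
    by rewrite !mulr_ge0// subr_ge0.
  by rewrite E2 E1; nra.
move=> t x y; rewrite !inE/= !in_itv/= => /andP[ax xb] /andP[ay yb].
have t0 : 0 <= t%:num by [].
have t1 : t%:num <= 1 by [].
rewrite !convRE.
have [xy|/ltW yx] := lerP x y; first by apply: key => //; rewrite t0.
have := key y x (1 - t%:num) ay xb yx.
rewrite subr_ge0 t1 gerBl t0 subKr => /(_ isT) H.
have E u v : t%:num * u + (1 - t%:num) * v = (1 - t%:num) * v + t%:num * u by rewrite addrC.
by move: H; rewrite -!E.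
Qed.

Lemma is_derive_inv (R : realFieldType) (f : R -> R) (x df : R) :
  f x != 0 -> is_derive x 1 f df ->
  is_derive x 1 (fun y => (f y)^-1) (- df / f x ^+ 2).
Proof.
move=> fx [df1 <-]; apply: DeriveDef; first exact: derivableV.
by rewrite deriveV// /GRing.scale/= mulNr mulrC mulNr.
Qed.

(** Serves the substitution [a = mu^-1 * lambda]: each differentiation in [lambda] brings out a
    factor [mu^-1]. *)
Lemma is_derive_rescale (R : realFieldType) (f : R -> R) (k c x df : R) :
  is_derive (c * x) 1 f df ->
  is_derive x 1 (fun y => k * f (c * y)) (k * c * df).
Proof.
move=> dfcx; pose g : R -> R := c \*: id.
have dg : is_derive x 1 g c.
  by have := is_deriveZ c (is_derive_id x 1); move/is_derive_eq; apply; exact: mulr1.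
have dg1 : derivable g x 1 by case: dg.
have df1 : derivable f (g x) 1 by case: dfcx.
have dfg : derivable (f \o g) x 1.
  have /derivable1_diffP dg2 := dg1; have /derivable1_diffP df2 := df1.
  exact/diff_derivable/(differentiable_comp dg2 df2).
have e : 'D_1 (f \o g) x = df * c.
  rewrite -derive1E (derive1_comp dg1 df1) !derive1E (@derive_val _ _ _ _ _ _ _ dg).
  by rewrite (@derive_val _ _ _ _ _ _ _ dfcx).
have := is_deriveZ k (DeriveDef dfg e).
move/is_derive_eq; apply; rewrite /GRing.scale/=; ring.
Qed.

(** Here [h] stands for [1 / x]. The system is closed under differentiation, so each derivative of
    [D] is [D] times a polynomial in [h], [p], [r], [z]. The relation [p r = h] is assumed at the
    point only, so [h] is differentiated as a function of its own before it is eliminated. *)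
Lemma derive3_of_logderiv (R : realType) (D h p r z : R -> R) (x : R) :
  is_derive x 1 D ((p x + r x + z x) * D x) ->
  is_derive x 1 h (- h x ^+ 2) ->
  is_derive x 1 p (- h x - h x * p x) ->
  is_derive x 1 r (r x ^+ 2) ->
  is_derive x 1 z (z x ^+ 2 + z x * p x - h x) ->
  p x * r x = h x ->
  is_derive x 1 (fun y => (p y + r y + z y) * D y)
    ((r x ^+ 2 + z x ^+ 2 + z x * p x - 2 * h x - h x * p x + (p x + r x + z x) ^+ 2) * D x) /\
  is_derive x 1 (fun y =>
    (r y ^+ 2 + z y ^+ 2 + z y * p y - 2 * h y - h y * p y + (p y + r y + z y) ^+ 2) * D y)
    (log_cubic (p x) (r x) (z x) * D x).
Proof.
move=> dD dh dp dr dz prh; split.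
  have -> : (fun y => (p y + r y + z y) * D y) = (p + r + z) * D by [].
  apply: is_derive_eq; rewrite -!prh /GRing.scale/= !fctE; ring.
have -> : (fun y =>
    (r y ^+ 2 + z y ^+ 2 + z y * p y - 2 * h y - h y * p y + (p y + r y + z y) ^+ 2) * D y) =
   (r ^+ 2 + z ^+ 2 + z * p - cst 2 * h - h * p + (p + r + z) ^+ 2) * D by [].
have d2 : is_derive x 1 (cst 2 : R -> R) 0 by exact: is_derive_cst.
have := is_deriveM (is_deriveD (is_deriveB (is_deriveB (is_deriveD (is_deriveD
  (is_deriveX 2 dr) (is_deriveX 2 dz)) (is_deriveM dz dp)) (is_deriveM d2 dh))
  (is_deriveM dh dp)) (is_deriveX 2 (is_deriveD (is_deriveD dp dr) dz))) dD.
move/is_derive_eq; apply; rewrite /log_cubic /GRing.scale/= !fctE -!prh.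
move: (p x) (r x) (z x) (D x) => P Q Z d; ring.
Qed.

(** * Partial sums of the exponential series *)

Section expsum.
Context {R : realType}.
Implicit Types (s n : nat) (x : R).

Definition expterm n x : R := x ^+ n / n`!%:R.

Definition expsum s x : R := \sum_(0 <= k < s) expterm k x.

Definition expsum2 s x : R := \sum_(0 <= j < s) expsum j.+1 x.

Lemma exptermS n x : n.+1%:R * expterm n.+1 x = x * expterm n x.
Proof.
rewrite /expterm factS natrM exprS; field.
by rewrite addrC natr1 !pnatr_eq0 -lt0n fact_gt0.
Qed.

Lemma expsumS s x : expsum s.+1 x = expsum s x + expterm s x.
Proof. by rewrite /expsum big_nat_recr. Qed.

Lemma expsum2S s x : expsum2 s.+1 x = expsum2 s x + expsum s.+1 x.
Proof. by rewrite /expsum2 big_nat_recr. Qed.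

(** Follows from [P = sum_(k < s) (s - k) e_k] and [k e_k = x e_(k-1)]. The right-hand side is
    [s - x] times the Erlang-C denominator at load [x], which is how [P] enters. *)
Lemma expsum2E s x : expsum2 s x = (s%:R - x) * expsum s x + s%:R * expterm s x.
Proof.
elim: s => [|s IH]; first by rewrite /expsum2 /expsum !big_geq// mulr0 mul0r addr0.
by rewrite expsum2S IH expsumS exptermS -natr1; ring.
Qed.

Lemma is_derive_expterm n x : is_derive x 1 (expterm n.+1) (expterm n x).
Proof.
rewrite /expterm.
have -> : (fun y : R => y ^+ n.+1 / n.+1`!%:R) = (n.+1`!%:R^-1) \*: (id ^+ n.+1 : R -> R).
  by apply/funext => y; rewrite /= fctE mulrC.
apply: is_derive_eq; rewrite /GRing.scale/= mulr1 factS natrM; field.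
by rewrite addrC natr1 !pnatr_eq0 -lt0n fact_gt0.
Qed.

Lemma is_derive_expsum s x : is_derive x 1 (expsum s.+1) (expsum s x).
Proof.
elim: s => [|s IH].
  have -> : expsum 1 = cst 1.
    by apply/funext => y; rewrite /expsum big_nat1 /expterm expr0 fact0 divr1.
  by rewrite /expsum big_geq//; exact: is_derive_cst.
have -> : expsum s.+2 = expsum s.+1 + expterm s.+1 by apply/funext => y; exact: expsumS.
rewrite expsumS; apply: is_deriveD; exact: is_derive_expterm.
Qed.

Lemma is_derive_expsum2 s x : is_derive x 1 (expsum2 s.+1) (expsum2 s x).
Proof.
elim: s => [|s IH].
  have -> : expsum2 1 = cst 1.
    by apply/funext => y; rewrite /expsum2 /expsum !big_nat1 /expterm expr0 fact0 divr1.
  by rewrite /expsum2 big_geq//; exact: is_derive_cst.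
have -> : expsum2 s.+2 = expsum2 s.+1 + expsum s.+2 by apply/funext => y; exact: expsum2S.
rewrite expsum2S; apply: is_deriveD; exact: is_derive_expsum.
Qed.

Lemma expterm_gt0 n x : 0 < x -> 0 < expterm n x.
Proof. by move=> x0; rewrite /expterm divr_gt0 ?exprn_gt0// ltr0n fact_gt0. Qed.

Lemma expsum_ge0 s x : 0 < x -> 0 <= expsum s x.
Proof. by move=> x0; apply: sumr_ge0 => k _; exact/ltW/expterm_gt0. Qed.

Lemma expsum_gt0 s x : 0 < x -> 0 < expsum s.+1 x.
Proof. by move=> x0; rewrite expsumS ltr_wpDl ?expsum_ge0 ?expterm_gt0. Qed.

Lemma expsum2_gt0 s x : 0 < x -> 0 < expsum2 s.+1 x.
Proof.
move=> x0; rewrite expsum2S ltr_wpDl ?expsum_gt0//.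
by apply: sumr_ge0 => k _; exact: expsum_ge0.
Qed.

(** Termwise, [x e_k = (k + 1) e_(k+1) <= s e_(k+1)] for [k < s]. *)
Lemma mul_expsum_le s x : 0 < x -> x * expsum s x <= s%:R * expsum s.+1 x.
Proof.
move=> x0; elim: s => [|s IH]; first by rewrite /expsum big_geq// mulr0 mul0r.
have e0 := expterm_gt0 s.+1 x0; have E0 := expsum_gt0 s x0.
rewrite expsumS mulrDr -exptermS [expsum s.+2 x]expsumS mulrDr lerD2r.
by apply: (le_trans IH); rewrite ler_wpM2r ?ler_nat// ltW.
Qed.

(** This is [sqr_expsum_ge] with a common product cancelled, a form suited to induction. In the
    step, cancelling again leaves [e_(s+1) P_s <= E_(s+1)^2]; multiplied by [s + 1], its left side
    is [x e_s P_s], and the induction hypothesis and [mul_expsum_le] bound it. *)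
Lemma expterm_expsum2_le s x : 0 < x ->
  expterm s x * expsum2 s x <= expsum s.+1 x * expsum s x.
Proof.
move=> x0; elim: s => [|s IH]; first by rewrite /expsum2 big_geq// mulr0 mulr_ge0 ?expsum_ge0.
rewrite expsum2S mulrDr [expsum s.+2 x]expsumS mulrDl addrC -subr_ge0.
suff : expterm s.+1 x * expsum2 s x <= expsum s.+1 x * expsum s.+1 x by lra.
rewrite -(ler_pM2l (_ : 0 < s.+1%:R :> R))// mulrA exptermS -mulrA.
apply: (le_trans (ler_wpM2l (ltW x0) IH)).
rewrite mulrCA [leRHS]mulrCA ler_wpM2l ?expsum_ge0//.
apply: (le_trans (mul_expsum_le s x0)).
by rewrite ler_wpM2r ?ler_nat ?expsum_ge0.
Qed.

Lemma sqr_expsum_ge n x : 0 < x ->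
  expterm n x * expsum2 n.+1 x <= expsum n.+1 x ^+ 2.
Proof.
move=> x0; have := expterm_expsum2_le n x0.
by rewrite expsum2S expsumS; lra.
Qed.

End expsum.

(** * The normalized delay with [n.+1] servers and its derivatives *)

Section delay.
Context {R : realType}.
Variable n : nat.
Let s : R := n.+1%:R.
Implicit Types x : R.

(** By [expsum2E] this is the Erlang-C probability at load [x] divided by [s - x]: the mean wait
    before service, in units of [1 / mu]. *)
Definition delay x : R :=
  s * expterm n.+1 x / ((s - x) * expsum2 n.+1 x).

Definition idle_ratio x : R := (s - x) / x.

Definition idle_inv x : R := (s - x)^-1.

Definition expsum_ratio x : R := expsum n.+1 x / expsum2 n.+1 x.

Let s_neq0 : s != 0.
Proof. by rewrite /s pnatr_eq0. Qed.

Lemma is_derive_idle_ratio x : x != 0 ->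
  is_derive x 1 idle_ratio (- x^-1 - x^-1 * idle_ratio x).
Proof.
move=> x0; rewrite /idle_ratio.
have dx := is_derive_inv x0 (is_derive_id x 1).
have -> : (fun y => (s - y) / y) = (cst s - id) * (fun y : R => y^-1) by [].
have := is_deriveM (is_deriveB (is_derive_cst s x 1) (is_derive_id x 1)) dx.
by move/is_derive_eq; apply; rewrite /GRing.scale/= !fctE; move: (s) => u; field.
Qed.

Lemma is_derive_idle_inv x : s - x != 0 ->
  is_derive x 1 idle_inv (idle_inv x ^+ 2).
Proof.
move=> sx; rewrite /idle_inv.
have := @is_derive_inv _ (cst s - id) x _ sx
  (is_deriveB (is_derive_cst s x 1) (is_derive_id x 1)).
by move/is_derive_eq; apply; rewrite !fctE; move: (s) sx => u sx'; field.
Qed.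

(** Since [E' = E - e_n] and [P' = P - E], the quotient rule gives [z' = z^2 - e_n / P], and
    [expsum2E] turns [e_n / P] into [1 / x - z p]. *)
Lemma is_derive_expsum_ratio x : 0 < x ->
  is_derive x 1 expsum_ratio
    (expsum_ratio x ^+ 2 + expsum_ratio x * idle_ratio x - x^-1).
Proof.
move=> x0; rewrite /expsum_ratio /idle_ratio.
have P0 : expsum2 n.+1 x != 0 by rewrite gt_eqF ?expsum2_gt0.
have := is_deriveM (is_derive_expsum n x) (is_derive_inv P0 (is_derive_expsum2 n x)).
move/is_derive_eq; apply; rewrite /GRing.scale/=.
have PE := expsum2E n.+1 x; have PS := expsum2S n x; have ES := expsumS n x.
rewrite exptermS -/s in PE.
have x1 : x != 0 by rewrite gt_eqF.
have {PS} PS : expsum2 n x = expsum2 n.+1 x - expsum n.+1 x by rewrite PS addrK.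
have {ES} -> : expsum n x = expsum n.+1 x - expterm n x by rewrite ES addrK.
have -> : expterm n x = (expsum2 n.+1 x - (s - x) * expsum n.+1 x) / x.
  by rewrite PE addrC addKr mulrC mulKf.
rewrite PS; move: (s) (expsum2 n.+1 x) (expsum n.+1 x) P0 => u P E P0.
by field; rewrite x1 P0.
Qed.

(** The logarithmic derivative is [s / x + 1 / (s - x) - P' / P], where [P' / P = 1 - z] and
    [s / x - 1 = p]. *)
Lemma is_derive_delay x : 0 < x -> x < s ->
  is_derive x 1 delay
    ((idle_ratio x + idle_inv x + expsum_ratio x) * delay x).
Proof.
move=> x0 xs; rewrite /delay /idle_ratio /idle_inv /expsum_ratio.
have P0 : expsum2 n.+1 x != 0 by rewrite gt_eqF ?expsum2_gt0.
have x1 : x != 0 by rewrite gt_eqF.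
have t0 : s - x != 0 by rewrite gt_eqF ?subr_gt0.
have tP0 : (s - x) * expsum2 n.+1 x != 0 by rewrite mulf_neq0.
have dt := is_deriveM (is_deriveB (is_derive_cst s x 1) (is_derive_id x 1))
  (is_derive_expsum2 n x).
have dn := is_deriveM (is_derive_cst s x 1) (is_derive_expterm n x).
have := is_deriveM dn (@is_derive_inv _ ((cst s - id) * expsum2 n.+1) x _ tP0 dt).
move/is_derive_eq; apply; rewrite /GRing.scale/= !fctE.
have -> : expsum2 n x = expsum2 n.+1 x - expsum n.+1 x by rewrite expsum2S addrK.
have -> : expterm n.+1 x = x * expterm n x / s by rewrite -exptermS -/s mulrC mulKf.
move: (s) (expsum2 n.+1 x) (expsum n.+1 x) (expterm n x) s_neq0 t0 P0 => u P E e u0 t0 P0.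
by field; rewrite x1 P0 t0 u0.
Qed.

Lemma log_cubic_ratios_ge0 x : 0 < x -> x < s ->
  0 <= log_cubic (idle_ratio x) (idle_inv x) (expsum_ratio x).
Proof.
move=> x0 xs.
have P0 := expsum2_gt0 n x0; have E0 := expsum_gt0 n x0.
have t0 : 0 < s - x by rewrite subr_gt0.
have x1 : x != 0 by rewrite gt_eqF.
have t1 : s - x != 0 by rewrite gt_eqF.
have [n2|n2] := leqP 2 n.
  apply: log_cubic_ge0; rewrite ?divr_gt0 ?invr_gt0//.
    (* The hypothesis [p r <= z^2 + z p] is [sqr_expsum_ge] divided by [P^2]. *)
    rewrite /idle_ratio /idle_inv /expsum_ratio.
    have -> : (s - x) / x * (s - x)^-1 = x^-1.
      by move: (s) t1 => u t1; field; rewrite x1 t1.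
    rewrite -subr_ge0.
    have := sqr_expsum_ge n x0; rewrite -subr_ge0.
    have PE := expsum2E n.+1 x; rewrite exptermS -/s in PE.
    have -> : expterm n x = (expsum2 n.+1 x - (s - x) * expsum n.+1 x) / x.
      by rewrite PE addrC addKr mulrC mulKf.
    move: (s) (expsum2 n.+1 x) (expsum n.+1 x) P0 => u P E P0 H.
    have -> : (E / P) ^+ 2 + E / P * ((u - x) / x) - x^-1 =
        (E ^+ 2 - (P - (u - x) * E) / x * P) / P ^+ 2.
      by field; rewrite x1 gt_eqF.
    by rewrite divr_ge0 ?exprn_ge0// ltW.
  (* [r <= 1/2] means [s - x >= 2], and [p <= 2] means [s - x <= 2 x]. For [x >= 1] the two ranges
     cover everything; for [x < 1] the first holds because [s >= 3]. *)
  have [x_ge1|x_lt1] := lerP 1 x.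
    have [t2|t2] := lerP 2 (s - x); [left|right].
      by rewrite /idle_inv ler_pdivrMr// mul1r.
    by rewrite /idle_ratio ler_pdivrMr//; lra.
  left; rewrite /idle_inv ler_pdivrMr// mul1r.
  have : 3 <= s by rewrite /s (ler_nat R 3).
  lra.
(* With one or two servers both alternatives fail for small [x], so the cubic is computed as a
   rational function of [x]. *)
move: t0 t1 xs P0 E0; rewrite /idle_ratio /idle_inv /expsum_ratio /s.
rewrite /expsum2 /expsum /expterm.
case: n n2 => [|[|//]] _ t0 t1 xs _ _.
  rewrite /index_iota /= !(big_cons, big_nil) /= !fact0 !expr0.
  suff -> : log_cubic ((1 - x) / x) (1 - x)^-1 (((1 / 1 + 0) / (1 / 1 + 0 + 0)) : R) =
      6 / (x * (1 - x) ^+ 3).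
    by rewrite divr_ge0// mulr_ge0 ?exprn_ge0// ltW.
  by rewrite /log_cubic; field; rewrite x1 t1.
have u_gt0 : 0 < 2 + x by rewrite addr_gt0.
have u0 : 2 + x != 0 by rewrite gt_eqF.
rewrite /index_iota /= !(big_cons, big_nil) /= !factS fact0 !expr0 !expr1.
have -> : (1 / (1 * 1)%:R + (x / (1 * 1)%:R + 0)) /
    (1 / 1 + 0 + (1 / 1 + (x / (1 * 1)%:R + 0) + 0)) = (1 + x) / (2 + x).
  by rewrite muln1; congr (_ / _); field.
suff -> : log_cubic ((2 - x) / x) (2 - x)^-1 ((1 + x) / (2 + x)) =
    96 * (4 + x ^+ 2) / (x * (2 - x) ^+ 3 * (2 + x) ^+ 3).
  by rewrite divr_ge0 ?mulr_ge0 ?exprn_ge0 ?(addr_ge0 _ (sqr_ge0 x))//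
    ?(ltW x0) ?(ltW t0) ?(ltW u_gt0).
by rewrite /log_cubic; field; rewrite x1 t1 u0.
Qed.

Lemma delay_ge0 x : 0 < x -> x < s -> 0 <= delay x.
Proof.
move=> x0 xs; apply: divr_ge0; apply: mulr_ge0.
- exact: ler0n.
- by rewrite ltW ?expterm_gt0.
- by rewrite subr_ge0 ltW.
- by rewrite ltW ?expsum2_gt0.
Qed.

End delay.

(** * Return to the arrival rate *)

Lemma waiting_time_delay (R : realType) (n : nat) (mu l : R) :
  0 < mu -> 0 < l < n.+1%:R * mu ->
  waiting_time mu n.+1 l = mu^-1 + mu^-1 * delay n (mu^-1 * l).
Proof.
move=> mu0 /andP[l0 ls].
have mu1 : mu != 0 by rewrite gt_eqF.
set a := mu^-1 * l.
have a0 : 0 < a by rewrite mulr_gt0 ?invr_gt0.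
have as_ : a < n.+1%:R by rewrite /a mulrC ltr_pdivrMr.
have la : l = a * mu by rewrite /a mulrAC mulVf ?mul1r.
have P0 := expsum2_gt0 n a0.
rewrite /delay expsum2E in P0 *.
rewrite /waiting_time /expected_customers /erlangC /utilization la mulfK//.
rewrite -/(expterm n.+1 a) -/(expsum n.+1 a).
move: (expterm n.+1 a) (expsum n.+1 a) P0 => e E P0.
have s0 : n.+1%:R != 0 :> R by rewrite pnatr_eq0.
move: (n.+1%:R) s0 as_ P0 => s s0 as_ P0.
have a1 : a != 0 by rewrite gt_eqF.
have t1 : s - a != 0 by rewrite gt_eqF// subr_gt0.
have -> : a * mu / (s * mu) = a / s by field; rewrite mu1 s0.
have -> : 1 - a / s = (s - a) / s by field.
(* The Erlang-C denominator is [P / (s - a)], with [P] already expanded by [expsum2E] in the goal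
   and in [P0]. *)
have -> : E + e * ((s - a) / s)^-1 = ((s - a) * E + s * e) / (s - a).
  by field; rewrite t1 s0.
by field; rewrite mu1 a1 t1 s0 gt_eqF.
Qed.

Unset Implicit Arguments.

Theorem lemma3 (R : realType) (s : nat) (mu : R)
    (s_ge1 : (1 <= s)%N) (mu_gt0 : 0 < mu) :
  (forall lambda : R, 0 < lambda < s%:R * mu ->
     derivable (waiting_time mu s) lambda 1) /\
  convex_function (`]0, s%:R * mu[%classic : set R) (waiting_time mu s)^`()%classic.
Proof.
case: s s_ge1 => // n _.
set I := `]0, n.+1%:R * mu[%R.
have inI (l : R) : l \in I -> 0 < mu^-1 * l /\ mu^-1 * l < n.+1%:R.
  by rewrite in_itv/= => /andP[l0 ls]; rewrite mulr_gt0 ?invr_gt0// mulrC ltr_pdivrMr.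
pose c : R := mu^-1.
pose D1 x := (idle_ratio n x + idle_inv n x + expsum_ratio n x) * delay n x : R.
have dW (l : R) : l \in I -> is_derive l 1 (waiting_time mu n.+1) (c * c * D1 (c * l)).
  move=> lI; have [l0 ls] := inI l lI.
  have dD := @is_derive_rescale _ _ c _ _ _ (is_derive_delay l0 ls).
  have := is_deriveD (is_derive_cst c l 1) dD.
  (* The formula [waiting_time_delay] is available only for stable rates, hence equality merely near
     [l]. *)
  rewrite add0r; apply: near_eq_is_derive.
  near=> k; rewrite waiting_time_delay//.
  suff : k \in I by rewrite in_itv.
  by near: k; exact: near_in_itvoo.
have dW' (l : R) : l \in I -> (waiting_time mu n.+1)^`()%classic l = c * c * D1 (c * l).
  by move=> /dW dWl; rewrite derive1E derive_val.
split; first by move=> l lI; have [] := dW l; rewrite ?in_itv.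
have c0 : 0 < c by rewrite invr_gt0.
(* [D1], [D2], [D3] are the successive derivatives of [delay]; the [i]-th derivative of the waiting
   time is [c^(i+1)] times [D_i] at [c * l]. *)
pose D2 x : R := (idle_inv n x ^+ 2 + expsum_ratio n x ^+ 2
  + expsum_ratio n x * idle_ratio n x - 2 * x^-1 - x^-1 * idle_ratio n x
  + (idle_ratio n x + idle_inv n x + expsum_ratio n x) ^+ 2) * delay n x.
pose D3 x : R := log_cubic (idle_ratio n x) (idle_inv n x) (expsum_ratio n x) * delay n x.
have dD (l : R) : l \in I ->
    is_derive (c * l) 1 D1 (D2 (c * l)) /\ is_derive (c * l) 1 D2 (D3 (c * l)).
  move=> /inI[]; rewrite -/c; set x := c * l => x0 xs.
  have x1 : x != 0 by rewrite gt_eqF.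
  have t1 : n.+1%:R - x != 0 by rewrite gt_eqF// subr_gt0.
  have dh : is_derive x 1 (fun y : R => y^-1) (- x^-1 ^+ 2).
    have := @is_derive_inv _ id x _ x1 (is_derive_id x 1).
    by move/is_derive_eq; apply; rewrite mulN1r exprVn.
  apply: (derive3_of_logderiv (is_derive_delay x0 xs) dh (is_derive_idle_ratio n x1)
    (is_derive_idle_inv t1) (is_derive_expsum_ratio n x0)).
  by rewrite /idle_ratio /idle_inv mulrAC divff// mul1r.
apply: (@convex_function_derive2_ge0 _ 0 (n.+1%:R * mu) ((waiting_time mu n.+1)^`()%classic)
  (fun l : R => c * c * c * D2 (c * l))
  (fun l : R => c * c * c * c * D3 (c * l))).
- move=> l lI; have [/(is_derive_rescale (c * c)) d1 _] := dD l lI.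
  apply: near_eq_is_derive d1; near=> k; rewrite dW'//.
  by near: k; exact: near_in_itvoo.
- by move=> l /dD[_ /(is_derive_rescale (c * c * c))].
- move=> l /inI[x0 xs]; apply: mulr_ge0; first by rewrite !mulr_ge0// ltW.
  by apply: mulr_ge0; [exact: log_cubic_ratios_ge0|exact: delay_ge0].
Unshelve. all: by end_near. Qed.
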